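(* A residuated lattice $L$ is finitely approximable if and only if its finite index topology is Hausdorff.
   Context: A residuated lattice is an algebra $(L,\wedge,\vee,\odot,\rightarrow,0,1)$ such that $(L,\wedge,\vee,0,1)$ is a bounded lattice, $(L,\odot,1)$ is a commutative monoid, and $x\odot y\le z$ iff $x\le y\rightarrow z$. A filter is a nonempty subset closed under $\odot$ and upward closed; for a filter $F$, $x/F$ is the class of $x$ under the congruence $\theta_F=\{(x,y):(x\rightarrow y)\odot(y\rightarrow x)\in F\}$ and $L/F$ the quotient. A filter $F$ has finite index if $L/F$ is finite; let $\mathcal{F}(L)_{fin}$ be the set of finite index filters (it is down-directed under inclusion). The finite index topology of $L$ is $\{U\subseteq L:\forall x\in U\ \exists F\in\mathcal{F}(L)_{fin},\ x/F\subseteq U\}$. $L$ is finitely approximable if it is isomorphic to a subalgebra of a product of finite residuated lattices. *)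

(* Defs.v *)
From HB Require Import structures.
From mathcomp Require Import all_boot all_order.
From mathcomp Require Import boolp classical_sets functions cardinality topology.

Set Implicit Arguments.
Unset Strict Implicit.
Unset Printing Implicit Defensive.

Import Order.LTheory.

Local Open Scope classical_set_scope.
Local Open Scope order_scope.

Declare Scope rl_scope.
Delimit Scope rl_scope with RL.
Local Open Scope rl_scope.

Reserved Notation "x ⊙ y" (at level 40, left associativity).
Reserved Notation "x ⇾ y" (at level 45, no associativity).

(* The degenerate algebra with \bot = \top is allowed. The choiceType structure
   inherited from the order hierarchy is no restriction on the carrier, by
   gen_eqMixin and gen_choiceMixin. *)
HB.mixin Record TBLattice_isResiduated (d : Order.disp_t) T
    of Order.TBLattice d T := {
  rmul : T -> T -> T;
  rimp : T -> T -> T;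
  rmulA : associative rmul;
  rmulC : commutative rmul;
  rmul1x : left_id (\top : T) rmul;
  rmul_adj : forall x y z : T, (rmul x y <= z) = (x <= rimp y z)
}.

#[short(type="residuatedLatticeType")]
HB.structure Definition ResiduatedLattice (d : Order.disp_t) :=
  {T of TBLattice_isResiduated d T & Order.TBLattice d T}.

Notation "x ⊙ y" := (rmul x y) : rl_scope.
Notation "x ⇾ y" := (rimp x y) : rl_scope.

Section Filters.
Context {d : Order.disp_t} {L : residuatedLatticeType d}.
Implicit Types (F G U : set L) (x y : L).

Definition rl_filter F : Prop :=
  [/\ F !=set0,
      forall x y, F x -> F y -> F (x ⊙ y)
    & forall x y, F x -> x <= y -> F y].

Definition theta F x y : Prop := F ((x ⇾ y) ⊙ (y ⇾ x)).

Definition rl_class F x : set L := [set y | theta F x y].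

Definition rl_quotient F : set (set L) := range (rl_class F).

Definition finite_index F : Prop := rl_filter F /\ finite_set (rl_quotient F).

Definition fin_index_open U : Prop :=
  forall x, U x -> exists2 F, finite_index F & rl_class F x `<=` U.

Lemma finite_indexT : finite_index setT.
Proof.
split; first by split => //; exists \top.
apply: (sub_finite_set _ (finite_set1 [set: L])).
by move=> _ [x _ <-]; apply/seteqP; split.
Qed.

Lemma finite_indexI F G :
  finite_index F -> finite_index G -> finite_index (F `&` G)%classic.
Proof.
move=> [[F0 FM FU] finF] [[G0 GM GU] finG].
have top1 H : H !=set0 -> (forall x y, H x -> x <= y -> H y) -> H \top.
  by move=> [x Hx] HU; apply: HU Hx (lex1 x).
split.
  split; first by exists \top; split; apply: top1.
    by move=> x y [Fx Gx] [Fy Gy]; split; [exact: FM|exact: GM].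
  by move=> x y [Fx Gx] xy; split; [exact: FU xy|exact: GU xy].
apply: (sub_finite_set _ (finite_image2 setI finF finG)).
move=> _ [x _ <-].
by exists (rl_class F x); [exists x|exists (rl_class G x); [exists x|]].
Qed.

Lemma fin_index_openT : fin_index_open setT.
Proof. by move=> x _; exists setT => //; exact: finite_indexT. Qed.

Lemma fin_index_openI : setI_closed fin_index_open.
Proof.
move=> U V oU oV x [/oU [F fiF FU] /oV [G fiG GV]].
exists (F `&` G)%classic; first exact: finite_indexI.
by move=> y [Fy Gy]; split; [exact: FU|exact: GV].
Qed.

Lemma fin_index_open_bigU (I : Type) (f : I -> set L) :
  (forall i, fin_index_open (f i)) -> fin_index_open (\bigcup_i f i).
Proof.
move=> of_ x [i _ /(of_ i) [F fiF sF]].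
by exists F => // y /sF fiy; exists i.
Qed.

End Filters.

(* An alias of L, carrying the finite index topology (see open_fin_indexE). *)
Definition fin_index_space (d : Order.disp_t) (L : residuatedLatticeType d) :
  Type := L.

Section FinIndexTopology.
Context (d : Order.disp_t) (L : residuatedLatticeType d).

HB.instance Definition _ := Choice.on (fin_index_space L).
HB.instance Definition _ := isOpenTopological.Build (fin_index_space L)
  (@fin_index_openT d L) (@fin_index_openI d L) (@fin_index_open_bigU d L).

Lemma open_fin_indexE (U : set (fin_index_space L)) :
  open U = fin_index_open (U : set L).
Proof. by []. Qed.

End FinIndexTopology.

Fact rl_prod_display : Order.disp_t. Proof. exact: Order.Disp tt tt. Qed.

Definition rl_prod (I : Type) (d : I -> Order.disp_t)
  (A : forall i, residuatedLatticeType (d i)) : Type := forall i, A i.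

Section Product.
Context (I : Type) (d : I -> Order.disp_t).
Context (A : forall i, residuatedLatticeType (d i)).
Local Notation P := (rl_prod A).
Implicit Types f g h : P.

HB.instance Definition _ := gen_eqMixin P.
HB.instance Definition _ := gen_choiceMixin P.

Definition prod_le f g : bool := `[< forall i, f i <= g i >].
Definition prod_meet f g : P := fun i => f i `&` g i.
Definition prod_join f g : P := fun i => f i `|` g i.
Definition prod_bot : P := fun i => \bot.
Definition prod_top : P := fun i => \top.
Definition prod_mul f g : P := fun i => f i ⊙ g i.
Definition prod_imp f g : P := fun i => f i ⇾ g i.

Lemma prod_le_refl : reflexive prod_le.
Proof. by move=> f; apply/asboolP. Qed.

Lemma prod_le_anti : antisymmetric prod_le.
Proof.
move=> f g /andP[/asboolP fg /asboolP gf].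
by apply: functional_extensionality_dep => i; apply/le_anti; rewrite fg gf.
Qed.

Lemma prod_le_trans : transitive prod_le.
Proof.
move=> g f h /asboolP fg /asboolP gh; apply/asboolP => i.
exact: le_trans (fg i) (gh i).
Qed.

HB.instance Definition _ :=
  Order.Le_isPOrder.Build rl_prod_display P
    prod_le_refl prod_le_anti prod_le_trans.

Lemma prod_meetP f g h : (f <= prod_meet g h) = (f <= g) && (f <= h).
Proof.
apply/asboolP/andP => [fgh|[/asboolP fg /asboolP fh] i]; last first.
  by rewrite lexI fg fh.
by split; apply/asboolP => i; have := fgh i; rewrite lexI => /andP[].
Qed.

Lemma prod_joinP f g h : (prod_join f g <= h) = (f <= h) && (g <= h).
Proof.
apply/asboolP/andP => [fgh|[/asboolP fh /asboolP gh] i]; last first.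
  by rewrite leUx fh gh.
by split; apply/asboolP => i; have := fgh i; rewrite leUx => /andP[].
Qed.

HB.instance Definition _ :=
  Order.POrder_MeetJoin_isLattice.Build rl_prod_display P
    prod_meetP prod_joinP.

Lemma prod_le0x f : prod_bot <= f.
Proof. by apply/asboolP => i; exact: le0x. Qed.

Lemma prod_lex1 f : f <= prod_top.
Proof. by apply/asboolP => i; exact: lex1. Qed.

HB.instance Definition _ :=
  Order.hasBottom.Build rl_prod_display P prod_le0x.
HB.instance Definition _ :=
  Order.hasTop.Build rl_prod_display P prod_lex1.

Lemma prod_mulA : associative prod_mul.
Proof.
by move=> f g h; apply: functional_extensionality_dep => i; exact: rmulA.
Qed.

Lemma prod_mulC : commutative prod_mul.
Proof.
by move=> f g; apply: functional_extensionality_dep => i; exact: rmulC.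
Qed.

Lemma prod_mul1x : left_id (\top : P) prod_mul.
Proof.
by move=> f; apply: functional_extensionality_dep => i; exact: rmul1x.
Qed.

Lemma prod_adj f g h : (prod_mul f g <= h) = (f <= prod_imp g h).
Proof.
by apply/asboolP/asboolP => H i; have := H i; rewrite rmul_adj.
Qed.

HB.instance Definition _ :=
  TBLattice_isResiduated.Build rl_prod_display P
    prod_mulA prod_mulC prod_mul1x prod_adj.

End Product.

Record rl_subalgebra (d : Order.disp_t) (L : residuatedLatticeType d)
    (S : set L) : Prop := RLSubalgebra {
  rl_sub0 : S \bot;
  rl_sub1 : S \top;
  rl_subI : forall x y, S x -> S y -> S (x `&` y);
  rl_subU : forall x y, S x -> S y -> S (x `|` y);
  rl_subM : forall x y, S x -> S y -> S (x ⊙ y);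
  rl_subR : forall x y, S x -> S y -> S (x ⇾ y)
}.

Record rl_hom (d d' : Order.disp_t) (L : residuatedLatticeType d)
    (M : residuatedLatticeType d') (f : L -> M) : Prop := RLHom {
  rl_hom0 : f \bot = \bot;
  rl_hom1 : f \top = \top;
  rl_homI : forall x y, f (x `&` y) = f x `&` f y;
  rl_homU : forall x y, f (x `|` y) = f x `|` f y;
  rl_homM : forall x y, f (x ⊙ y) = f x ⊙ f y;
  rl_homR : forall x y, f (x ⇾ y) = f x ⇾ f y
}.

Definition rl_iso_onto (d d' : Order.disp_t) (L : residuatedLatticeType d)
    (M : residuatedLatticeType d') (S : set M) : Prop :=
  exists2 f : L -> M, rl_hom f & set_bij [set: L] S f.

Definition finitely_approximable (d : Order.disp_t)
    (L : residuatedLatticeType d) : Prop :=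
  exists (I : Type) (e : I -> Order.disp_t)
         (A : forall i, residuatedLatticeType (e i)) (S : set (rl_prod A)),
    [/\ forall i, finite_set [set: A i],
        rl_subalgebra S
      & rl_iso_onto L S].

(* Main.v *)
Require Import Defs.
From HB Require Import structures.
From mathcomp Require Import all_boot all_order.
From mathcomp Require Import boolp classical_sets functions cardinality topology.

(** A homomorphism [f] of [L] to a finite algebra has the finite index filter
    [f^-1(1)], whose classes are the fibres of [f]; so if such homomorphisms
    separate the points of [L], disjoint classes do. Conversely, in a Hausdorff
    finite index topology distinct points [x], [y] have [y] outside [x/F] for
    some finite index [F], hence [L] embeds in the product of all its finite
    quotients. *)

Set Implicit Arguments.
Unset Strict Implicit.
Unset Printing Implicit Defensive.

Import Order.LTheory.

Local Open Scope classical_set_scope.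
Local Open Scope order_scope.
Local Open Scope rl_scope.
Local Open Scope quotient_scope.

(** * Arithmetic of residuation *)

Section Residuation.
Context {d : Order.disp_t} {L : residuatedLatticeType d}.
Implicit Types x y z : L.

Lemma rmulx1 : right_id (\top : L) (@rmul d L).
Proof. by move=> x; rewrite rmulC rmul1x. Qed.

Lemma rmul_impl x y : (x ⇾ y) ⊙ x <= y.
Proof. by rewrite rmul_adj. Qed.

Lemma rmul_le2l z x y : x <= y -> x ⊙ z <= y ⊙ z.
Proof. by move=> xy; rewrite rmul_adj (le_trans xy)// -rmul_adj. Qed.

Lemma rmul_le2 x x' y y' : x <= x' -> y <= y' -> x ⊙ y <= x' ⊙ y'.
Proof.
move=> xx' yy'; apply: le_trans (rmul_le2l _ xx') _.
by rewrite ![x' ⊙ _]rmulC rmul_le2l.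
Qed.

Lemma rmul_lel x y : x ⊙ y <= x.
Proof. by rewrite -[leRHS]rmulx1 rmul_le2// lex1. Qed.

Lemma rmul_ler x y : x ⊙ y <= y.
Proof. by rewrite rmulC rmul_lel. Qed.

Lemma rimp_top x y : (x ⇾ y == \top) = (x <= y).
Proof. by rewrite -le1x -rmul_adj rmul1x. Qed.

Lemma rmul_top x y : (x ⊙ y == \top) = (x == \top) && (y == \top).
Proof.
apply/idP/andP => [|[/eqP-> /eqP->]]; last by rewrite rmul1x.
by rewrite -!le1x => h; split; apply: le_trans h _;
  rewrite (rmul_lel, rmul_ler).
Qed.

Lemma rimpI x y z : x ⇾ (y `&` z) = (x ⇾ y) `&` (x ⇾ z).
Proof.
apply/le_anti; rewrite lexI -!rmul_adj lexI.
rewrite (le_trans (rmul_impl _ _) (leIl _ _)).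
rewrite (le_trans (rmul_impl _ _) (leIr _ _)) /=.
by rewrite !rmul_adj leIl leIr.
Qed.

Lemma rimpU x y z : (x `|` y) ⇾ z = (x ⇾ z) `&` (y ⇾ z).
Proof.
have le_imp t : (t <= (x `|` y) ⇾ z) = (t <= (x ⇾ z) `&` (y ⇾ z)).
  by rewrite lexI -!rmul_adj !(rmulC t) !rmul_adj leUx.
by apply/le_anti; rewrite le_imp lexx -le_imp lexx.
Qed.

(** Currying: by adjunction and associativity both sides have the same lower bounds. It yields the
    adjunction in quotients. *)
Lemma rimpM x y z : (x ⊙ y) ⇾ z = x ⇾ (y ⇾ z).
Proof.
by apply/le_anti; rewrite -!rmul_adj -rmulA !rmul_adj lexx -!rmul_adj rmulA
  !rmul_adj lexx.
Qed.

Lemma rimp_trans x y z : (x ⇾ y) ⊙ (y ⇾ z) <= x ⇾ z.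
Proof.
rewrite -rmul_adj [(x ⇾ y) ⊙ _]rmulC -rmulA.
exact: le_trans (rmul_le2 (lexx _) (rmul_impl _ _)) (rmul_impl _ _).
Qed.

(** After adjunction, regroup the factors so that [rmul_impl] applies to each pair. This is what
    makes [theta F] compatible with [⊙]. *)
Lemma rimp_mul x x' y y' : (x ⇾ x') ⊙ (y ⇾ y') <= (x ⊙ y) ⇾ (x' ⊙ y').
Proof.
rewrite -rmul_adj rmulA -[X in X ⊙ y]rmulA [(y ⇾ y') ⊙ x]rmulC rmulA -rmulA.
by rewrite rmul_le2// rmul_impl.
Qed.

End Residuation.

(** * Filters and their congruences *)

Section FilterCongruence.
Context {d : Order.disp_t} {L : residuatedLatticeType d}.
Context {F : set L} (FF : rl_filter F).
Implicit Types x y z : L.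

Lemma filter_le x y : F x -> x <= y -> F y.
Proof. by case: FF => _ _; apply. Qed.

Lemma filter_imp_le x y : x <= y -> F (x ⇾ y).
Proof.
rewrite -rimp_top => /eqP->; case: FF => -[x0 Fx0] _ _.
exact: filter_le Fx0 (lex1 _).
Qed.

Lemma filter_mul x y : F (x ⊙ y) <-> F x /\ F y.
Proof.
split=> [Fxy|[]]; last by case: FF => _ FM _; exact: FM.
by split; apply: filter_le Fxy _; rewrite (rmul_lel, rmul_ler).
Qed.

(** Closure under meets comes from closure under products, since [x ⊙ y] lies below the meet. *)
Lemma filter_meet x y : F (x `&` y) <-> F x /\ F y.
Proof.
split=> [Fxy|/filter_mul Fxy].
  by split; apply: filter_le Fxy _; rewrite (leIl, leIr).
by apply: filter_le Fxy _; rewrite lexI rmul_lel rmul_ler.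
Qed.

Lemma filter_imp_trans y x z : F (x ⇾ y) -> F (y ⇾ z) -> F (x ⇾ z).
Proof.
move=> Fxy Fyz; apply: filter_le (rimp_trans x y z).
exact/filter_mul.
Qed.

Lemma thetaE x y : theta F x y <-> F (x ⇾ y) /\ F (y ⇾ x).
Proof. exact: filter_mul. Qed.

Lemma theta_refl x : theta F x x.
Proof. by apply/thetaE; split; exact: filter_imp_le. Qed.

Lemma theta_sym x y : theta F x y -> theta F y x.
Proof. by rewrite /theta rmulC. Qed.

Lemma theta_trans y x z : theta F x y -> theta F y z -> theta F x z.
Proof.
move=> /thetaE[xy yx] /thetaE[yz zy]; apply/thetaE.
by split; apply: (filter_imp_trans (y := y)).
Qed.

(** By transitivity a class contains the class of each of its points, so [F] itself is the witness
    everywhere. *)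
Lemma rl_class_open x :
  finite_index F -> fin_index_open (rl_class F x).
Proof.
by move=> fiF y xy; exists F => // z; exact: theta_trans xy.
Qed.

End FilterCongruence.

(** * The quotient residuated lattice *)

Fact rl_quot_display : Order.disp_t. Proof. exact: Order.Disp tt tt. Qed.

Section Quotient.
Context (d : Order.disp_t) (L : residuatedLatticeType d).
Context (F : set L) (FF : rl_filter F).

Definition thetab (x y : L) : bool := `[< theta F x y >].

Lemma thetab_equiv : equiv_class_of thetab.
Proof.
split=> [x|x y|y x z]; first exact/asboolP/theta_refl.
- by apply/asboolP/asboolP; exact: theta_sym.
- by move=> /asboolP xy /asboolP yz; apply/asboolP/(theta_trans FF xy).
Qed.

Canonical thetab_equiv_rel := EquivRelPack thetab_equiv.

Definition rl_quot : Type := {eq_quot thetab_equiv_rel}.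
HB.instance Definition _ := Quotient.on rl_quot.
HB.instance Definition _ := Choice.on rl_quot.

Local Notation Q := rl_quot.
Local Notation pi := (\pi_Q : L -> Q).
Implicit Types (a b c : Q) (x y z : L).

Lemma pi_eq x y : pi x = pi y <-> theta F x y.
Proof.
split=> [/eqmodP/asboolP //|xy].
exact/eqmodP/asboolP.
Qed.

Lemma theta_repr x : theta F (repr (pi x)) x.
Proof. by apply/pi_eq; rewrite reprK. Qed.

(** The order and the operations are computed on chosen representatives; independence of the choice
    is proved afterwards. *)
Definition quot_le a b : bool := `[< F (repr a ⇾ repr b) >].
Definition quot_meet a b : Q := pi (repr a `&` repr b).
Definition quot_join a b : Q := pi (repr a `|` repr b).
Definition quot_mul a b : Q := pi (repr a ⊙ repr b).
Definition quot_imp a b : Q := pi (repr a ⇾ repr b).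

Lemma quot_le_pi x y : quot_le (pi x) (pi y) = `[< F (x ⇾ y) >].
Proof.
have /(thetaE FF)[xr rx] := theta_repr x.
have /(thetaE FF)[yr ry] := theta_repr y.
by apply: asbool_equiv_eq; split=> h;
  [apply: filter_imp_trans FF _ _ _ rx _; apply: filter_imp_trans FF _ _ _ h yr
  |apply: filter_imp_trans FF _ _ _ xr _; apply: filter_imp_trans FF _ _ _ h ry].
Qed.

Lemma quot_le_refl : reflexive quot_le.
Proof. by move=> a; apply/asboolP/filter_imp_le. Qed.

Lemma quot_le_anti : antisymmetric quot_le.
Proof.
move=> a b /andP[/asboolP ab /asboolP ba].
by rewrite -[a]reprK -[b]reprK; apply/pi_eq/thetaE.
Qed.

Lemma quot_le_trans : transitive quot_le.
Proof.
move=> b a c /asboolP ab /asboolP bc; apply/asboolP.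
exact: filter_imp_trans FF _ _ _ ab bc.
Qed.

HB.instance Definition _ :=
  Order.Le_isPOrder.Build rl_quot_display Q
    quot_le_refl quot_le_anti quot_le_trans.

Lemma le_pi x y : (pi x <= pi y) = `[< F (x ⇾ y) >].
Proof. exact: quot_le_pi. Qed.

(** [rimpI] turns the universal property of the meet into membership of a meet in [F]. As [x] and
    [y] are arbitrary, this also covers independence of representatives. *)
Lemma le_pi_meet a x y :
  (a <= pi (x `&` y)) = (a <= pi x) && (a <= pi y).
Proof.
elim/quotW: a => z; rewrite !le_pi rimpI -asbool_and.
exact/asbool_equiv_eq/filter_meet.
Qed.

Lemma le_pi_join a x y :
  (pi (x `|` y) <= a) = (pi x <= a) && (pi y <= a).
Proof.
elim/quotW: a => z; rewrite !le_pi rimpU -asbool_and.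
exact/asbool_equiv_eq/filter_meet.
Qed.

Lemma quot_meetP a b c : (a <= quot_meet b c) = (a <= b) && (a <= c).
Proof. by rewrite le_pi_meet !reprK. Qed.

Lemma quot_joinP a b c : (quot_join a b <= c) = (a <= c) && (b <= c).
Proof. by rewrite le_pi_join !reprK. Qed.

HB.instance Definition _ :=
  Order.POrder_MeetJoin_isLattice.Build rl_quot_display Q
    quot_meetP quot_joinP.

Lemma quot_le0x a : pi \bot <= a.
Proof. by elim/quotW: a => x; rewrite le_pi; apply/asboolP/filter_imp_le. Qed.

Lemma quot_lex1 a : a <= pi \top.
Proof. by elim/quotW: a => x; rewrite le_pi; apply/asboolP/filter_imp_le. Qed.

HB.instance Definition _ :=
  Order.hasBottom.Build rl_quot_display Q quot_le0x.
HB.instance Definition _ :=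
  Order.hasTop.Build rl_quot_display Q quot_lex1.

(** Unlike the lattice operations, the product is handled as a congruence, through [rimp_mul]. *)
Lemma quot_mul_pi x y : quot_mul (pi x) (pi y) = pi (x ⊙ y).
Proof.
apply/pi_eq/(thetaE FF).
have /(thetaE FF)[xr rx] := theta_repr x.
have /(thetaE FF)[yr ry] := theta_repr y.
by split; apply: filter_le FF _ _ _ (rimp_mul _ _ _ _); apply/filter_mul.
Qed.

Lemma quot_mulA : associative quot_mul.
Proof.
elim/quotW=> x; elim/quotW=> y; elim/quotW=> z.
by rewrite (quot_mul_pi x y) (quot_mul_pi y z) !quot_mul_pi rmulA.
Qed.

Lemma quot_mulC : commutative quot_mul.
Proof. by move=> a b; rewrite /quot_mul rmulC. Qed.

Lemma quot_mul1x : left_id (\top : Q) quot_mul.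
Proof. by elim/quotW=> x; rewrite quot_mul_pi rmul1x. Qed.

Lemma le_pi_imp a x y : (a <= pi (x ⇾ y)) = (quot_mul a (pi x) <= pi y).
Proof. by elim/quotW: a => z; rewrite quot_mul_pi !le_pi rimpM. Qed.

Lemma quot_adj a b c : (quot_mul a b <= c) = (a <= quot_imp b c).
Proof. by rewrite le_pi_imp !reprK. Qed.

HB.instance Definition _ :=
  TBLattice_isResiduated.Build rl_quot_display Q
    quot_mulA quot_mulC quot_mul1x quot_adj.

Lemma pi_hom : @rl_hom _ rl_quot_display L Q pi.
Proof.
split=> // x y.
(* For meet, join and implication, both sides satisfy the same universal property, so antisymmetry
   concludes. *)
- by apply/le_anti; rewrite lexI -le_pi_meet lexx le_pi_meet leIl leIr.
- by apply/le_anti; rewrite leUx -le_pi_join lexx le_pi_join leUl leUr.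
- by rewrite -quot_mul_pi.
- by apply/le_anti; rewrite -rmul_adj -le_pi_imp lexx le_pi_imp quot_adj lexx.
Qed.

Lemma finite_rl_quot : finite_set (rl_quotient F) -> finite_set [set: Q].
Proof.
move=> finF; pose g a := rl_class F (repr a).
have g_inj : {in [set: Q] &, injective g}.
  move=> a b _ _ gab; rewrite -[a]reprK -[b]reprK; apply/pi_eq.
  (* [repr b] lies in its own class [g b], which equals [g a]; hence the two representatives are
     congruent. *)
  by have : g b (repr b); [exact: theta_refl|rewrite -gab].
rewrite -(eq_finite_set (inj_card_eq g_inj)).
by apply: sub_finite_set finF => _ [a _ <-]; exists (repr a).
Qed.

End Quotient.

(** * Images and kernels of homomorphisms *)

Section Homomorphisms.
Context (d d' : Order.disp_t).
Context (L : residuatedLatticeType d) (M : residuatedLatticeType d').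
Context (f : L -> M) (fh : rl_hom f).

Lemma rl_hom_le x y : x <= y -> f x <= f y.
Proof. by move=> /meet_idPl xy; rewrite -xy (rl_homI fh) leIr. Qed.

Lemma rl_hom_image : rl_subalgebra (range f).
Proof.
split; [by exists \bot; rewrite ?(rl_hom0 fh)|
        by exists \top; rewrite ?(rl_hom1 fh)|..].
- by move=> _ _ [x _ <-] [y _ <-]; exists (x `&` y); rewrite ?(rl_homI fh).
- by move=> _ _ [x _ <-] [y _ <-]; exists (x `|` y); rewrite ?(rl_homU fh).
- by move=> _ _ [x _ <-] [y _ <-]; exists (x ⊙ y); rewrite ?(rl_homM fh).
- by move=> _ _ [x _ <-] [y _ <-]; exists (x ⇾ y); rewrite ?(rl_homR fh).
Qed.

Definition rl_ker : set L := [set x | f x = \top].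

Lemma rl_ker_filter : rl_filter rl_ker.
Proof.
split; first by exists \top; exact: rl_hom1.
- by move=> x y fx fy; rewrite /rl_ker /= (rl_homM fh) fx fy rmul1x.
- move=> x y fx /rl_hom_le; rewrite fx le1x => /eqP fy.
  exact: fy.
Qed.

(** A product is [\top] only if both factors are, and an implication is [\top] exactly when the
    inequality holds; antisymmetry does the rest. *)
Lemma theta_ker x y : theta rl_ker x y <-> f x = f y.
Proof.
rewrite /theta /rl_ker /= (rl_homM fh) !(rl_homR fh).
split=> [/eqP|->].
  by rewrite rmul_top !rimp_top => fxy; apply/le_anti.
by apply/eqP; rewrite rmul_top rimp_top lexx.
Qed.

Lemma finite_index_ker : finite_set [set: M] -> finite_index rl_ker.
Proof.
move=> finM; split; first exact: rl_ker_filter.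
(* Every class is the fibre over some point of the finite [M]. *)
pose fibre a := [set y | a = f y].
apply: sub_finite_set (finite_image fibre finM) => _ [x _ <-].
exists (f x) => //; apply/seteqP.
by split=> y /= /theta_ker.
Qed.

End Homomorphisms.

(** * Hausdorff separation by finite index filters *)

Section Separation.
Context (d : Order.disp_t) (L : residuatedLatticeType d).

Lemma hausdorff_fin_indexP :
  hausdorff_space (fin_index_space L) <->
  forall x y : L, x <> y -> exists2 F, finite_index F & ~ theta F x y.
Proof.
rewrite open_hausdorff; split=> [sep x y /eqP xy|sep x y /eqP xy].
  have [[U V] /= [/set_mem Ux /set_mem Vy] [oU oV /eqP UV0]] := sep x y xy.
  (* If [y] were in the class of [x], it would lie in both disjoint sets [U] and [V]. *)
  have [F fiF FU] := oU x Ux; exists F => // /FU Uy.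
  have : (U `&` V)%classic y by [].
  by rewrite UV0.
have [F fiF nxy] := sep x y xy; have FF := fiF.1.
exists (rl_class F x, rl_class F y) => /=.
  by split; apply/mem_set; exact: theta_refl.
split; [exact: rl_class_open|exact: rl_class_open|].
(* A common point of the two classes would make [x] and [y] congruent. *)
apply/eqP/seteqP; split=> // z [xz yz]; apply: nxy.
exact: (theta_trans FF xz (theta_sym yz)).
Qed.

End Separation.

Theorem theorem8p2 (d : Order.disp_t) (L : residuatedLatticeType d) :
  finitely_approximable L <-> hausdorff_space (fin_index_space L).
Proof.
rewrite hausdorff_fin_indexP; split.
  move=> [I [e [A [S [finA _ [f fh [_ f_inj _]]]]]]] x y xy.
  have [i fxyi] : exists i, f x i <> f y i.
    apply/existsNP => fxy; apply/xy/f_inj; rewrite ?inE//.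
    exact: functional_extensionality_dep.
  (* A coordinate that distinguishes [x] from [y] is itself a homomorphism to a finite algebra; its
     kernel is the required filter. *)
  pose fi z := f z i.
  have fih : rl_hom fi.
    by case: fh => f0 f1 fI fU fM fR; split; move=> *;
      rewrite /fi ?f0 ?f1 ?fI ?fU ?fM ?fR.
  exists (rl_ker fi); first exact: finite_index_ker.
  by move/(theta_ker fih).
move=> sep.
(* Each index carries its proof of [finite_index], which supplies both the algebra structure and the
   finiteness of its factor. *)
pose I := {F : set L | finite_index F}.
pose A (i : I) : residuatedLatticeType rl_quot_display :=
  rl_quot (proj1 (proj2_sig i)).
pose f (x : L) : rl_prod A := fun i => \pi_(rl_quot (proj1 (proj2_sig i))) x.
have fh : rl_hom f.
  have pih (i : I) := pi_hom (proj1 (proj2_sig i)).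
  split=> *; apply: functional_extensionality_dep => i.
  - exact: rl_hom0 (pih i).
  - exact: rl_hom1 (pih i).
  - exact: rl_homI (pih i) _ _.
  - exact: rl_homU (pih i) _ _.
  - exact: rl_homM (pih i) _ _.
  - exact: rl_homR (pih i) _ _.
exists I, (fun=> rl_quot_display), A, (range f); split.
- by move=> i; exact: finite_rl_quot (proj2 (proj2_sig i)).
- exact: rl_hom_image.
- exists f => //; split=> [x _|x y _ _ fxy|//]; first by exists x.
  (* If [x] and [y] differed, some [F] would separate them, yet equality of the images at coordinate
     [F] says [theta F x y]. *)
  apply: contrapT => /sep[F fiF]; apply.
  apply/(pi_eq fiF.1).
  exact: (congr1 (fun g : rl_prod A => g (exist _ F fiF)) fxy).
Qed.
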